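(* Let $[a,b]\subset[1,\infty)$ be a compact interval with $a<b$, and let $\mathcal{F}_{a,b}$ be the set of continuous probability densities supported on $[a,b]$ that are piecewise polynomial. For a nonprincipal ultrafilter $\mathcal{U}$ on $\mathbb{N}$, let $\preceq$ be the relation on $\mathcal{F}_{a,b}$ given by: $f\preceq g$ if and only if the hyperreal number represented by the moment sequence of $f$ is less than or equal to the hyperreal number represented by the moment sequence of $g$ in $\mathbb{R}^{\mathbb{N}}/\mathcal{U}$. Then $\mathcal{F}_{a,b}$ is totally ordered under $\preceq$, and the ordering is independent of the ultrafilter $\mathcal{U}$, i.e., any two nonprincipal ultrafilters on $\mathbb{N}$ induce the same relation $\preceq$ on $\mathcal{F}_{a,b}$.
   Context: A probability density supported on $[a,b]$ is a nonnegative function $f:[a,b]\to\mathbb{R}$ with $\int_a^b f(t)\,dt=1$; continuity means continuity on $[a,b]$. A function on $[a,b]$ is piecewise polynomial if there is a finite partition $a=t_1<t_2<\dots<t_n=b$ such that the function coincides with a polynomial on each subinterval of the partition. The moment sequence of $f$ is $(m_f(n))_{n\in\mathbb{N}}$ with $m_f(n)=\int_a^b x^n f(x)\,dx$. Given a nonprincipal ultrafilter $\mathcal{U}$ on $\mathbb{N}$, the hyperreals are ${}^*\mathbb{R}=\mathbb{R}^{\mathbb{N}}/\mathcal{U}$, where sequences $(x_n)$ and $(y_n)$ are identified if $\{n: x_n=y_n\}\in\mathcal{U}$, with the total order $[(x_n)]\le[(y_n)]$ if and only if $\{n: x_n\le y_n\}\in\mathcal{U}$. Every real sequence, in particular every moment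 sequence, represents a hyperreal number. *)

(* Defs.v *)
From HB Require Import structures.
From mathcomp Require Import all_boot all_order all_algebra.
From mathcomp Require Import all_classical all_reals all_analysis.

Set Implicit Arguments.
Unset Strict Implicit.
Unset Printing Implicit Defensive.

Import Order.TTheory GRing.Theory Num.Theory.
Import numFieldNormedType.Exports.

Local Open Scope classical_set_scope.
Local Open Scope ring_scope.
Local Open Scope quotient_scope.

Definition is_total_order_on (T : Type) (A : set T) (r : T -> T -> Prop) :
    Prop :=
  [/\ forall x, A x -> r x x,
      forall x y, A x -> A y -> r x y -> r y x -> x = y,
      forall x y z, A x -> A y -> A z -> r x y -> r y z -> r x z
    & total_on A r].

Record nonprincipal_ultrafilter := NonprincipalUltrafilter {
  nonprincipal_filter : set_system nat;
  nonprincipal_ultra :: UltraFilter nonprincipal_filter;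
  nonprincipalP : forall n, nonprincipal_filter <> principal_filter n }.

Section hyperreal.
Variables (R : realType) (U : nonprincipal_ultrafilter).

Definition hyper_eq (x y : R^nat) : bool := `[< nonprincipal_filter U [set n | x n = y n] >].

Lemma hyper_eq_refl : reflexive hyper_eq.
Proof. by move=> x; apply/asboolP; apply: filterE. Qed.

Lemma hyper_eq_sym : symmetric hyper_eq.
Proof.
by move=> x y; apply/asboolP/asboolP; apply: filterS => n /= ->.
Qed.

Lemma hyper_eq_trans : transitive hyper_eq.
Proof.
move=> y x z /asboolP xy /asboolP yz; apply/asboolP.
by apply: filterS2 xy yz => n /= -> ->.
Qed.

Canonical hyper_equiv :=
  EquivRel hyper_eq hyper_eq_refl hyper_eq_sym hyper_eq_trans.

Definition hyperreal := {eq_quot hyper_equiv}.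

Definition hyper (x : R^nat) : hyperreal := \pi_{eq_quot hyper_equiv} x.

Lemma hyperP (x y : R^nat) : hyper x = hyper y <-> nonprincipal_filter U [set n | x n = y n].
Proof.
split=> [/eqmodP /asboolP //|xy].
by apply/eqmodP; apply/asboolP.
Qed.

Lemma hyperK (c : hyperreal) : hyper (repr c) = c.
Proof. exact: reprK. Qed.

(* The order on the quotient is defined on representatives; [hyper_leP] shows
   that it does not depend on their choice. *)
Definition hyper_le (c d : hyperreal) : Prop :=
  nonprincipal_filter U [set n | repr c n <= repr d n].

Lemma hyper_leP (x y : R^nat) :
  hyper_le (hyper x) (hyper y) <-> nonprincipal_filter U [set n | x n <= y n].
Proof.
have /hyperP hx := hyperK (hyper x); have /hyperP hy := hyperK (hyper y).
split=> h; first by apply: filterS3 hx hy h => n /= -> ->.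
by apply: filterS3 hx hy h => n /= <- <-.
Qed.

Lemma hyper_le_total_order : is_total_order_on setT hyper_le.
Proof.
split=> [c _|c d _ _ cd dc|c d e _ _ _ cd de|c d _ _].
- by apply: filterE => n /=.
- rewrite -(hyperK c) -(hyperK d); apply/hyperP.
  by apply: filterS2 cd dc => n /= cd dc; apply/le_anti; rewrite cd dc.
- by apply: filterS2 cd de => n /=; exact: le_trans.
- have [|h] := in_ultra_setVsetC [set n | repr c n <= repr d n]
    (nonprincipal_ultra U); first by left.
  by right; apply: filterS h => n /= /negP; rewrite -ltNge => /ltW.
Qed.

End hyperreal.

Section densities.
Variables (R : realType) (a b : R).

(* Open pieces: continuity at the breakpoints is not built into the notion. *)
Definition piecewise_polynomial (f : R -> R) : Prop :=
  exists2 s : seq R, itv_partition a b s &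
    forall i, (i < size s)%N -> exists p : {poly R},
      forall x, x \in `]nth b (a :: s) i, nth b (a :: s) i.+1[ -> f x = p.[x].

(* A function on [a, b] is represented by its extension by 0 to R, so that
   equality of representatives is equality of functions on [a, b]. *)
Definition probability_density : set (R -> R) :=
  [set f | [/\ forall x, x \notin `[a, b] -> f x = 0,
               forall x, x \in `[a, b] -> 0 <= f x
             & (\int[@lebesgue_measure R]_(x in `[a, b]) (f x)%:E = 1)%E]].

Definition pp_density : set (R -> R) :=
  [set f | [/\ probability_density f,
               {within `[a, b], continuous f}
             & piecewise_polynomial f]].

Definition moment (f : R -> R) : R^nat :=
  fun n => \int[@lebesgue_measure R]_(x in `[a, b]) (x ^+ n * f x).

Definition moment_le (U : nonprincipal_ultrafilter) (f g : R -> R) : Prop :=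
  hyper_le (hyper U (moment f)) (hyper U (moment g)).

End densities.

(* Main.v *)
(* For distinct f and g in the class, the difference h = g - f vanishes on a
   maximal final segment [d, b] of [a, b] and, being polynomial just to the left
   of d, has a constant strict sign on some ]c, d[.  If h > 0 there, then h >= 0
   on [c, b] and h >= m > 0 on some [e1, e2] with c < e1, so the n-th moment of h
   is at least e1^n m (e2 - e1) - c^n M (b - a), where |h| <= M on [a, c].  Since
   0 < c < e1 this is eventually positive.  Hence two distinct densities have
   moment sequences that are eventually strictly ordered, and a nonprincipal
   ultrafilter contains every cofinite set. *)

Require Import Defs.
From HB Require Import structures.
From mathcomp Require Import all_boot all_order all_algebra.
From mathcomp Require Import all_classical all_reals all_analysis.
From mathcomp Require Import lra.

Import Order.TTheory GRing.Theory Num.Theory.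
Import numFieldNormedType.Exports.

Local Open Scope classical_set_scope.
Local Open Scope ring_scope.

(** * Cofinite sets in a nonprincipal ultrafilter *)

(** If {k} were in U, then U would contain the principal filter at k, hence equal it by
    maximality. *)
Lemma nonprincipal_setC1 (U : nonprincipal_ultrafilter) (k : nat) :
  nonprincipal_filter U [set~ k].
Proof.
have [Uk|//] := in_ultra_setVsetC [set k] (nonprincipal_ultra U).
case: (@nonprincipalP U k).
have UU := nonprincipal_ultra U.
apply: (@max_filter _ _ (principal_filter_ultra k)) => W /principal_filterP Wk.
by apply: filterS Uk => _ ->.
Qed.

(** The final segments of nat stay in U because their points are removed one at a time. *)
Lemma nonprincipal_eventually (U : nonprincipal_ultrafilter) (A : set nat) :
  (\forall n \near \oo, A n) -> nonprincipal_filter U A.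
Proof.
have UU := nonprincipal_ultra U.
case=> N _ NA; suff : nonprincipal_filter U [set n | (N <= n)%N].
  exact: filterS.
elim: N {NA} => [|N IH]; first exact: filterE.
apply: filterS2 IH (nonprincipal_setC1 U N) => n /= Nn nN.
by rewrite ltn_neqAle Nn andbT eq_sym; apply/eqP.
Qed.

(** * Sign of a piecewise polynomial function before its last zero *)

Section sign_before_last_zero.
Variable R : realType.
Implicit Types (a b c x y : R) (f g h : R -> R).

(** Dividing p by the full power of X - x leaves a cofactor nonzero at x, whose sign persists
    nearby. The factor (-1)^m is moved into [r], so that (x - y)^m is positive on the left of x. *)
Lemma poly_left_sign (p : {poly R}) x : p != 0 ->
  exists2 c, c < x & (forall y, c < y < x -> 0 < p.[y]) \/
                     (forall y, c < y < x -> p.[y] < 0).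
Proof.
move=> p0; have [m [q /implyP/(_ p0) qx pE]] := multiplicity_XsubC p x.
(* Near x on the left, p has the sign of r at x. *)
pose r := (-1) ^+ m *: q.
have pr y : p.[y] = r.[y] * (x - y) ^+ m.
  rewrite pE hornerM horner_exp hornerXsubC -(opprB x y) exprNn hornerZ.
  by rewrite mulrA [q.[y] * _]mulrC.
have rx : r.[x] != 0 by rewrite hornerZ mulf_neq0// signr_eq0.
have cr : r.[y] @[y --> x] --> r.[x] := @continuous_horner _ r x.
have [r0|r0] := ltrP 0 r.[x].
- have rn : nbhs x [set y | 0 < r.[y]] by exact: cvgr_gt cr _ r0.
  have [e /= e0 re] := (nbhs_ballP _ _).1 rn.
  exists (x - e); first lra.
  left=> y /andP[xy yx]; rewrite pr mulr_gt0 ?exprn_gt0 ?subr_gt0//.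
  by apply: re; rewrite /ball/= gtr0_norm; lra.
- have {}r0 : r.[x] < 0 by rewrite lt_neqAle rx.
  have rn : nbhs x [set y | r.[y] < 0] by exact: cvgr_lt cr _ r0.
  have [e /= e0 re] := (nbhs_ballP _ _).1 rn.
  exists (x - e); first lra.
  right=> y /andP[xy yx]; rewrite pr nmulr_rlt0 ?exprn_gt0 ?subr_gt0//.
  by apply: re; rewrite /ball/= gtr0_norm; lra.
Qed.

(** The piece to take is the first one whose right end reaches x; if x is a breakpoint, this is the
    piece ending at x. *)
Lemma piecewise_polynomial_left a b f x : piecewise_polynomial a b f ->
  a < x <= b -> exists2 c, a <= c < x &
    exists p : {poly R}, forall y, c < y < x -> f y = p.[y].
Proof.
case=> s; elim: s a => [|t s IH] a ps fs /andP[ax xb].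
  by move/itv_partition_nil: ps ax xb => ->; lra.
have [xt|tx] := leP x t.
  exists a; first by rewrite lexx.
  have [p fp] := fs 0%N isT; exists p => y /andP[ay yx].
  by apply: fp; rewrite in_itv/= ay (lt_le_trans yx).
have at_ : a < t by case: ps => /= /andP[].
have [|i si||c /andP[tc cx] fc] := IH t.
- exact: itv_partition_cons ps.
- exact: (fs i.+1 si).
- by rewrite tx.
- by exists c => //; rewrite cx (le_trans (ltW at_)).
Qed.

(** Pieces are open intervals, so sign information has to be carried to their endpoints by
    continuity. *)
Lemma within_continuous_ge0 a b h u v x : {within `[a, b], continuous h} ->
  a <= u -> u < v -> v <= b -> (forall y, u < y < v -> 0 <= h y) ->
  u <= x <= v -> 0 <= h x.
Proof.
move=> /subspace_continuousP hc au uv vb huv /andP[ux xv].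
rewrite leNgt; apply/negP => hx0.
have xab : `[a, b]%classic x by rewrite /= in_itv/=; apply/andP; split; lra.
have hn : nbhs x [set y | `[a, b]%classic y -> h y < 0].
  exact: cvgr_lt (hc x xab) _ hx0.
have [e /= e0 he] := (nbhs_ballP _ _).1 hn.
(* ]l, r[ is the intersection of ]u, v[ with the e-ball around x; its midpoint contradicts the sign
   of h. *)
pose l := Num.max u (x - e); pose r := Num.min v (x + e).
have lr : l < r by rewrite gt_max !lt_min; apply/andP; split; apply/andP; split; lra.
have [ul xl] : u <= l /\ x - e <= l by rewrite !le_max !lexx orbT.
have [rv rx] : r <= v /\ r <= x + e by rewrite !ge_min !lexx orbT.
pose y := (l + r) / 2.
have ly : l < y by rewrite /y; lra.
have yr : y < r by rewrite /y; lra.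
have : h y < 0.
  apply: he; first by rewrite /ball/= ltr_norml; apply/andP; split; lra.
  by rewrite /= in_itv/=; apply/andP; split; lra.
by apply/negP; rewrite -leNgt; apply: huv; apply/andP; split; lra.
Qed.

Lemma within_continuous_eq0 a b h u v x : {within `[a, b], continuous h} ->
  a <= u -> u < v -> v <= b -> (forall y, u < y < v -> h y = 0) ->
  u <= x <= v -> h x = 0.
Proof.
move=> hc au uv vb huv xuv; apply/eqP; rewrite eq_le -oppr_ge0; apply/andP; split.
- have hcN : {within `[a, b], continuous (- h)}.
    by move=> z; exact: continuousN (hc z).
  apply: (within_continuous_ge0 a b (- h) u v) => // y yuv.
  by rewrite fctE huv// oppr0.
- by apply: (within_continuous_ge0 a b h u v) => // y yuv; rewrite huv.
Qed.

(** This is exactly the data used by the moment estimate. The strict gap c < e1 is what makes c^n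
    negligible against e1^n. *)
Definition positive_tail a b h := exists c e1 e2 m,
  [/\ a <= c < e1, e1 < e2 <= b, 0 < m,
      forall x, c <= x <= b -> 0 <= h x &
      forall x, e1 <= x <= e2 -> m <= h x].

Lemma positive_tail_itv a b h c d : {within `[a, b], continuous h} ->
  a <= c -> c < d -> d <= b -> (forall x, c < x < d -> 0 < h x) ->
  (forall x, d < x < b -> h x = 0) -> positive_tail a b h.
Proof.
move=> hc ac cd db hcd hdb.
(* Any compact segment inside ]c, d[ would do: h attains a positive minimum on it. *)
pose e1 := c + (d - c) / 4; pose e2 := c + (d - c) / 2.
have ce1 : c < e1 by rewrite /e1; lra.
have e12 : e1 < e2 by rewrite /e1 /e2; lra.
have e2d : e2 < d by rewrite /e2; lra.
have hc12 : {within `[e1, e2], continuous h}.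
  apply: continuous_subspaceW hc => x /=; rewrite !in_itv/= => /andP[? ?].
  by apply/andP; split; lra.
have [z ze hz] := EVT_min (ltW e12) hc12.
have hz0 : 0 < h z.
  by apply: hcd; move: ze; rewrite in_itv/= => /andP[? ?]; apply/andP; split; lra.
exists c, e1, e2, (h z); split => //.
- by rewrite ac ce1.
- by apply/andP; split => //; lra.
- move=> x /andP[cx xb]; have [xd|dx] := leP x d.
    apply: (within_continuous_ge0 a b h c d) => // [y ycd|]; last by rewrite cx.
    exact/ltW/hcd.
  rewrite (within_continuous_eq0 a b h d b) //; [lra|lra|].
  by rewrite ltW.
Qed.

(** The polynomial hypothesis is local on the left of each point, so it passes to differences
    without a common refinement of two partitions. *)
Lemma tail_trichotomy a b h : a < b -> {within `[a, b], continuous h} ->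
  (forall x, a < x <= b -> exists2 c, a <= c < x &
    exists p : {poly R}, forall y, c < y < x -> h y = p.[y]) ->
  [\/ forall x, a <= x <= b -> h x = 0,
      positive_tail a b h | positive_tail a b (- h)].
Proof.
move=> ab hc hp.
pose E := [set y | a <= y <= b /\ forall x, y < x < b -> h x = 0].
have Eb : E b by split=> [|x]; [rewrite (ltW ab) lexx|lra].
have Elb : lbound E a by move=> y [/andP[]].
have infE : has_inf E by split; [exists b|exists a].
pose d := inf E.
have ad : a <= d by apply: lb_le_inf => //; exists b.
have db : d <= b by apply: ge_inf => //; exists a.
have hd x : d < x < b -> h x = 0.
  (* The infimum belongs to E: any x > d has a point of E before it. *)
  move=> /andP[dx xb]; have /inf_adherent/(_ infE)[y [_ yE]] : 0 < x - d by lra.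
  by rewrite -/d => yx; apply: yE; apply/andP; split; lra.
have [da|da] := leP d a.
  apply: Or31 => x axb; have ed : d = a by apply/le_anti; rewrite da.
  by apply: (within_continuous_eq0 a b h a b) => // y; rewrite -ed; exact: hd.
have [|c /andP[ac cd] [p hcp]] := hp d; first by rewrite da.
(* A zero piece would put c < d in E, against the choice of d. *)
have [p0|p0] := eqVneq p 0.
  exfalso; have hcd y : c < y < d -> h y = 0.
    by move=> /hcp ->; rewrite p0 horner0.
  suff : d <= c by lra.
  apply: ge_inf; first by exists a.
  split=> [|x /andP[cx xb]]; first by apply/andP; split; lra.
  have [xd|dx] := leP x d; last by apply: hd; rewrite dx.
  by apply: (within_continuous_eq0 a b h c d) => //; rewrite xd ltW.
have [c' cd' sgp] := poly_left_sign p d p0.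
pose e := Num.max c c'.
have [ce c'e] : c <= e /\ c' <= e by rewrite !le_max !lexx orbT.
have ed : e < d by rewrite gt_max cd.
have he y : e < y < d -> h y = p.[y] by move=> ?; apply: hcp; lra.
have ae : a <= e by lra.
case: sgp => sgp; [apply: Or32|apply: Or33].
- apply: (positive_tail_itv _ _ _ e d) => // x xed; rewrite he//.
  by apply: sgp; lra.
- apply: (positive_tail_itv _ _ _ e d) => //.
  + by move=> z; exact: continuousN (hc z).
  + move=> x xed; rewrite fctE oppr_gt0 he//.
    by apply: sgp; lra.
  + by move=> x xdb; rewrite fctE hd// oppr0.
Qed.

End sign_before_last_zero.

Arguments positive_tail {R}.

(** * Eventual comparison of moments *)

Section moments.
Variable R : realType.
Implicit Types (a b : R) (f g h : R -> R).
Local Notation mu := (@lebesgue_measure R).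

Lemma segment_integrable a b f : {within `[a, b], continuous f} ->
  mu.-integrable `[a, b] (EFin \o f).
Proof.
by move=> fc; apply: continuous_compact_integrable => //; exact: segment_compact.
Qed.

Lemma within_continuousM (A : set R) f g : {within A, continuous f} ->
  {within A, continuous g} -> {within A, continuous (f * g)}.
Proof. by move=> fc gc z; exact: continuousM (fc z) (gc z). Qed.

Lemma Rintegral_segment_cst a b r : a <= b ->
  \int[mu]_(_ in `[a, b]) r = r * (b - a).
Proof.
move=> ab; rewrite Rintegral_cst//= lebesgue_measure_itv/= lte_fin.
by case: ltgtP ab => // -> _; rewrite subrr mulr0.
Qed.

Lemma within_continuous_moment (A : set R) f n : {within A, continuous f} ->
  {within A, continuous (fun x => x ^+ n * f x)}.
Proof.
move=> fc; apply: (within_continuousM A (fun x => x ^+ n) f) => //.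
by apply: continuous_subspaceT => x; exact: exprn_continuous.
Qed.

Lemma momentB a b f g n : {within `[a, b], continuous f} ->
  {within `[a, b], continuous g} ->
  moment a b (f - g) n = moment a b f n - moment a b g n.
Proof.
move=> fc gc; rewrite /moment -RintegralB//.
- by apply: eq_Rintegral => x _; rewrite !fctE mulrBr.
- exact/segment_integrable/within_continuous_moment.
- exact/segment_integrable/within_continuous_moment.
Qed.

Lemma le_Rintegral_subsegment a b u v f : {within `[a, b], continuous f} ->
  a <= u -> v <= b -> (forall x, a <= x <= b -> 0 <= f x) ->
  \int[mu]_(x in `[u, v]) f x <= \int[mu]_(x in `[a, b]) f x.
Proof.
move=> fc au vb f0.
have sub : `[u, v] `<=` `[a, b].
  by apply: subset_itv; rewrite bnd_simp.
have fi := segment_integrable _ _ _ fc.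
have fi' : mu.-integrable `[u, v] (EFin \o f) by apply: integrableS fi.
apply: fine_le; [exact: integrable_fin_num|exact: integrable_fin_num|].
apply: ge0_subset_integral => //.
- by case/integrableP: fi.
Qed.

Lemma positive_tail_moment a b h : 0 < a -> {within `[a, b], continuous h} ->
  positive_tail a b h -> \forall n \near \oo, 0 < moment a b h n.
Proof.
move=> a0 hc [c [e1 [e2 [m [/andP[ac ce1] /andP[e12 e2b] m0 hcb hm]]]]].
have c0 : 0 < c by lra.
have e0 : 0 < e1 by lra.
have ab : a <= b by lra.
have [z _ hz] := EVT_min ab hc.
(* Since z minimizes h, -M bounds h from below; the absolute value makes M nonnegative. *)
pose M := `|h z|.
have hM x : a <= x <= b -> - M <= h x.
  by move=> xab; apply: le_trans (hz x xab); rewrite lerNl ler_normr lexx orbT.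
have M0 : 0 <= M := normr_ge0 _.
have lb n : e1 ^+ n * m * (e2 - e1) <= moment a b h n + c ^+ n * M * (b - a).
  (* Adding the constant c^n M makes the integrand nonnegative, so that the
     integral can be restricted to [e1, e2]. *)
  pose F x := x ^+ n * h x + c ^+ n * M.
  have cst k (u v : R) : {within `[u, v], continuous (fun=> k : R)}.
    by apply: continuous_subspaceT => x; exact: cvg_cst.
  have Fc : {within `[a, b], continuous F}.
    exact: within_continuousD (within_continuous_moment _ _ n hc) (cst _ _ _).
  have F0 x : a <= x <= b -> 0 <= F x.
    move=> xab; have x0 : 0 <= x by lra.
    have cM0 : 0 <= c ^+ n * M by rewrite mulr_ge0 ?exprn_ge0// ltW.
    have [cx|xc] := leP c x.
      by rewrite addr_ge0// mulr_ge0 ?exprn_ge0// hcb//; lra.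
    (* For x < c: x^n h(x) >= -x^n M >= -c^n M. *)
    rewrite /F -lerBlDr sub0r; apply: (@le_trans _ _ (x ^+ n * - M)).
      rewrite mulrN lerN2 ler_wpM2r// lerXn2r ?nnegrE//; lra.
    by rewrite ler_wpM2l ?exprn_ge0// hM.
  have -> : moment a b h n + c ^+ n * M * (b - a) = \int[mu]_(x in `[a, b]) F x.
    rewrite RintegralD//; first by rewrite Rintegral_segment_cst.
    - exact/segment_integrable/within_continuous_moment.
    - exact/segment_integrable/cst.
  apply: (@le_trans _ _ (\int[mu]_(x in `[e1, e2]) F x)); last first.
    by apply: le_Rintegral_subsegment => //; lra.
  rewrite -Rintegral_segment_cst; last exact: ltW.
  apply: le_Rintegral => //.
  - exact/segment_integrable/cst.
  - apply: segment_integrable; apply: continuous_subspaceW Fc.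
    by apply: subset_itv; rewrite bnd_simp; lra.
  - move=> x /=; rewrite in_itv/= => xe; have /hm hx := xe.
    have e1x : e1 <= x by lra.
    rewrite /F -[leLHS]addr0 lerD//; last first.
      by rewrite mulr_ge0 ?exprn_ge0// ltW.
    by rewrite ler_pM ?exprn_ge0// ?lerXn2r ?nnegrE// ?(ltW e0)//; lra.
pose K := m * (e2 - e1).
have K0 : 0 < K by rewrite mulr_gt0// subr_gt0.
(* After division of [lb] by e1^n, the error term is geometric of ratio c / e1 < 1 and drops below
   K. *)
have cv : geometric (M * (b - a)) (c / e1) n @[n --> \oo] --> 0.
  apply: cvg_geometric; rewrite gtr0_norm ?divr_gt0//.
  by rewrite ltr_pdivrMr// mul1r.
apply: filterS (cvgr_lt _ cv _ K0) => n /=.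
rewrite expr_div_n mulrA ltr_pdivrMr ?exprn_gt0// => ltK.
have := lb n; rewrite -mulrA -/K => {}lb.
move: ltK lb; rewrite mulrC mulrA (mulrC K).
lra.
Qed.

Lemma moment_eventually_total a b f g : 0 < a -> a < b ->
  pp_density a b f -> pp_density a b g ->
  [\/ f = g, \forall n \near \oo, moment a b f n < moment a b g n |
      \forall n \near \oo, moment a b g n < moment a b f n].
Proof.
move=> a0 ab [[f0 _ _] fc fp] [[g0 _ _] gc gp].
have hc : {within `[a, b], continuous (f - g)} by exact: within_continuousB.
have [x xab|fg|gf|gf] := tail_trichotomy _ a b (f - g) ab hc.
- have [c /andP[ac cx] [p fE]] := piecewise_polynomial_left _ _ _ _ _ fp xab.
  have [d /andP[ad dx] [q gE]] := piecewise_polynomial_left _ _ _ _ _ gp xab.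
  exists (Num.max c d); first by rewrite le_max ac gt_max cx.
  exists (p - q) => y; rewrite gt_max => /andP[/andP[cy dy] yx].
  by rewrite hornerD hornerN -fE -?gE ?cy ?dy ?yx.
(* Equality must hold on all of R; outside [a, b] both densities are 0. *)
- apply: Or31; apply/funext => x; have [xab|xab] := boolP (x \in `[a, b]).
    apply/eqP; rewrite -subr_eq0; apply/eqP.
    by move: xab; rewrite in_itv/= => /fg.
  by rewrite f0// g0.
- apply: Or33; have := positive_tail_moment _ _ _ a0 hc gf.
  by apply: filterS => n; rewrite momentB// subr_gt0.
- have hcN : {within `[a, b], continuous (g - f)} by exact: within_continuousB.
  apply: Or32; rewrite opprB in gf.
  have := positive_tail_moment _ _ _ a0 hcN gf.
  by apply: filterS => n; rewrite momentB// subr_gt0.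
Qed.

End moments.

(** * Total order and independence of the ultrafilter *)

Theorem lemma4p2 (R : realType) (a b : R) (ha : 1 <= a) (hab : a < b) :
  (forall U : nonprincipal_ultrafilter,
     is_total_order_on (pp_density a b) (moment_le a b U)) /\
  (forall (U V : nonprincipal_ultrafilter) (f g : R -> R),
     pp_density a b f -> pp_density a b g ->
     (moment_le a b U f g <-> moment_le a b V f g)).
Proof.
have a0 : 0 < a := lt_le_trans ltr01 ha.
have leU U f g : (\forall n \near \oo, moment a b f n < moment a b g n) ->
    moment_le a b U f g.
  move=> fg; apply/hyper_leP; apply: nonprincipal_eventually.
  by apply: filterS fg => n /ltW.
(* Two sets of U carrying opposite inequalities would have a common index. *)
have nleU U f g : (\forall n \near \oo, moment a b f n < moment a b g n) ->
    ~ moment_le a b U g f.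
  move=> /(nonprincipal_eventually U) fg /hyper_leP gf.
  have UU := nonprincipal_ultra U.
  have [n [/= fgn gfn]] := filter_ex (filterI fg gf).
  by move: gfn; rewrite leNgt fgn.
have tri := moment_eventually_total R a b _ _ a0 hab.
split=> [U|U V f g Ff Fg].
  (* All but antisymmetry is inherited from the hyperreals; antisymmetry needs the trichotomy,
     because equal hyperreals only mean moments equal on a set of U. *)
  have [le_refl _ le_tr le_tot] := hyper_le_total_order R U.
  split=> [f _|f g Ff Fg fg gf|f g h _ _ _|f g _ _].
  - exact: le_refl.
  - by have [//|/nleU/(_ gf)|/nleU/(_ fg)] := tri f g Ff Fg.
  - exact: le_tr.
  - exact: le_tot.
(* The trichotomy does not mention the ultrafilter, so each case settles both relations alike. *)
have [->|fg|gf] := tri f g Ff Fg.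
- have [reflU _ _ _] := hyper_le_total_order R U.
  have [reflV _ _ _] := hyper_le_total_order R V.
  by split=> _; [exact: reflV|exact: reflU].
- by split=> _; exact: leU.
- by split=> /nleU; [move=> /(_ gf)|move=> /(_ gf)].
Qed.
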